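(* Let $(A,\mu)$ be a Jordan algebra and let $\alpha,\beta:A\to A$ be two commuting algebra morphisms. Then $(A,\mu'=\mu\circ(\alpha\otimes\beta),\alpha,\beta)$ is a BiHom-Jordan algebra.
   Context: All vector spaces are over an algebraically closed field $\mathbb{K}$ of characteristic $0$. A Jordan algebra is a vector space with a commutative bilinear multiplication $\mu$ satisfying $as(\mu(x,x),y,x)=0$ for all $x,y$, where $as(x,y,z)=\mu(\mu(x,y),z)-\mu(x,\mu(y,z))$. For a quadruple $(A,\mu,\alpha,\beta)$ with $\mu:A\otimes A\to A$, $\alpha,\beta:A\to A$ linear, the BiHom-associator is $as_{\alpha,\beta}(x,y,z)=\mu(\mu(x,y),\beta(z))-\mu(\alpha(x),\mu(y,z))$. A BiHom-Jordan algebra is such a quadruple with, for all $x,y\in A$: (i) $\alpha\beta=\beta\alpha$; (ii) $\mu(\beta(x),\alpha(y))=\mu(\beta(y),\alpha(x))$; (iii) $as_{\alpha,\beta}\big(\mu(\beta^2(x),\alpha\beta(x)),\alpha^2\beta(y),\alpha^3(x)\big)=0$, where $as_{\alpha,\beta}$ is formed with the multiplication of the quadruple in question. *)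

(* Defs.v *)
From mathcomp Require Import all_boot all_algebra.

Set Implicit Arguments.
Unset Strict Implicit.
Unset Printing Implicit Defensive.

Import GRing.Theory.
Local Open Scope ring_scope.

Section BiHom.
Variables (K : fieldType) (A : lmodType K).
Implicit Types (mu : A -> A -> A) (alpha beta : A -> A) (x y z : A).

(* A linear map [A (x) A -> A] is represented by the corresponding bilinear
   map. *)
Definition is_bilinear mu : Prop := bilinear_for *:%R *:%R mu.

Definition associator mu x y z : A := mu (mu x y) z - mu x (mu y z).

Record jordan_algebra mu : Prop := JordanAlgebra {
  jordan_bilinear : is_bilinear mu;
  jordan_commutative : commutative mu;
  jordan_identity : forall x y, associator mu (mu x x) y x = 0
}.

Record algebra_morphism mu (f : A -> A) : Prop := AlgebraMorphism {
  algebra_morphism_linear : linear f;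
  algebra_morphism_mul : {morph f : x y / mu x y}
}.

Definition bihom_associator mu alpha beta x y z : A :=
  mu (mu x y) (beta z) - mu (alpha x) (mu y z).

Record bihom_jordan_algebra mu alpha beta : Prop := BiHomJordanAlgebra {
  bihom_jordan_bilinear : is_bilinear mu;
  bihom_jordan_linear_alpha : linear alpha;
  bihom_jordan_linear_beta : linear beta;
  bihom_jordan_comm_maps : alpha \o beta =1 beta \o alpha;
  bihom_jordan_commutative :
    forall x y, mu (beta x) (alpha y) = mu (beta y) (alpha x);
  bihom_jordan_identity : forall x y,
    bihom_associator mu alpha beta
      (mu (iter 2 beta x) (alpha (beta x)))
      (iter 2 alpha (beta y))
      (iter 3 alpha x) = 0
}.

Definition twist mu alpha beta : A -> A -> A :=
  fun x y => mu (alpha x) (beta y).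

End BiHom.

(* Main.v *)
Require Import Defs.
From mathcomp Require Import all_boot all_algebra.

(** Commuting morphisms can be pushed through products onto the variables. The powers in the BiHom
    identities are balanced so that both variables then carry the same composite of [alpha] and
    [beta], which leaves a law of [mu] at image points. *)

Theorem theorem4p1 (K : closedFieldType) (char0 : [pchar K]%R =i pred0)
    (A : lmodType K) (mu : A -> A -> A) (alpha beta : A -> A)
    (jordan_mu : jordan_algebra mu)
    (morph_alpha : algebra_morphism mu alpha)
    (morph_beta : algebra_morphism mu beta)
    (alpha_beta_comm : alpha \o beta =1 beta \o alpha) :
  bihom_jordan_algebra (twist mu alpha beta) alpha beta.
Proof.
case: jordan_mu => -[linl linr] muC jordan.
case: morph_alpha => lin_alpha alphaM; case: morph_beta => lin_beta betaM.
(* Oriented so that rewriting brings every composite to the form [alpha]^i [beta]^j. *)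
have comm x : beta (alpha x) = alpha (beta x) by apply/esym/alpha_beta_comm.
split=> //.
- split=> [z k x y | z k x y]; rewrite /twist.
    by rewrite lin_alpha; apply: linl.
  by rewrite lin_beta; apply: linr.
(* Both sides are products of [alpha (beta x)] and [alpha (beta y)]. *)
- by move=> x y; rewrite /twist !comm muC.
(* This is the Jordan identity of [mu] at [alpha^3 beta^2 x], [alpha^3 beta^2 y]. *)
- move=> x y; rewrite /bihom_associator /twist /= !(alphaM, betaM, comm).
  exact: jordan.
Qed.
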